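(* Let $k$ be a field of characteristic $0$, let $p>2$ be an integer, and let $A=k[x]/(x^p)$. In the Hochschild cohomology $\mathrm{HH}^*(A)$, let $x^i\xi_1^*$ $(1\le i\le p-1)$ and $x^j\xi_2^*$ $(0\le j\le p-1)$ denote the classes of degree $1$ and degree $2$ defined by the corresponding cocycles on the periodic resolution $\mathbb{A}$ of $A$. Then the Gerstenhaber brackets are $$[x^i\xi_1^*,x^j\xi_1^*]=(j-i)\,x^{i+j-1}\xi_1^*\qquad(1\le i,j\le p-1),$$ $$[x^i\xi_1^*,x^j\xi_2^*]=(j-p)\,x^{i+j-1}\xi_2^*\qquad(1\le i\le p-1,\ 0\le j\le p-1),$$ $$[x^i\xi_2^*,x^j\xi_2^*]=0\qquad(0\le i,j\le p-1).$$
   Context: Write $A^e=A\otimes_kA^{op}$. The periodic resolution $\mathbb{A}$ of $A$ as an $A^e$-module is $$\cdots\xrightarrow{v\cdot}A^e\xrightarrow{u\cdot}A^e\xrightarrow{v\cdot}A^e\xrightarrow{u\cdot}A^e\xrightarrow{\pi}A\to0,$$ where $u=x\otimes1-1\otimes x$, $v=x^{p-1}\otimes1+x^{p-2}\otimes x+\cdots+1\otimes x^{p-1}$, and $\pi$ is multiplication; $\mathbb{A}_n=A^e$ for all $n\ge0$, and the differential $\mathbb{A}_n\to\mathbb{A}_{n-1}$ is multiplication by $u$ for $n$ odd and by $v$ for $n\ge2$ even. Let $\xi_n=1\otimes1\in\mathbb{A}_n$, and let $x^j\xi_n^*\in\operatorname{Hom}_{A^e}(\mathbb{A}_n,A)$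 be the $A^e$-linear map sending $\xi_n$ to $x^j$ (so it is $0$ if $j\ge p$). The same symbol denotes its class in $\mathrm{HH}^n(A)=\operatorname{Ext}^n_{A^e}(A,A)$ when it is a cocycle. One has $\mathrm{HH}^1(A)\cong(x)$ and $\mathrm{HH}^2(A)\cong A/(x^{p-1})$. The Gerstenhaber bracket on $\mathrm{HH}^*(A)$ is defined on the bar resolution, with cochains $\operatorname{Hom}_k(A^{\otimes n},A)$: for $f$ of degree $m$ and $g$ of degree $n$, $$(f\circ g)(a_1\otimes\cdots\otimes a_{m+n-1})=\sum_{i=1}^m(-1)^{(n-1)(i-1)}f(a_1\otimes\cdots\otimes a_{i-1}\otimes g(a_i\otimes\cdots\otimes a_{i+n-1})\otimes a_{i+n}\otimes\cdots\otimes a_{m+n-1}),$$ $[f,g]=f\circ g-(-1)^{(m-1)(n-1)}g\circ f$. It is transported to classes represented on $\mathbb{A}$ via the canonical isomorphism of cohomologies induced by a comparison map of $A^e$-projective resolutions lifting $\mathrm{id}_A$. *)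

(* Defs.v *)
From HB Require Import structures.
From mathcomp Require Import all_boot all_algebra falgebra.

Set Implicit Arguments.
Unset Strict Implicit.
Unset Printing Implicit Defensive.

Import GRing.Theory.
Local Open Scope ring_scope.

(* The tensor power of a finite-dimensional space is modelled in coordinates: *)
(* a tensor is its array of coefficients on the tensors of basis vectors.     *)
(* Sequences of vectors are only meaningful at length n.  tlift F is the      *)
(* linear map sending v_1 (x) .. (x) v_n to F [:: v_1; ..; v_n], for F        *)
(* multilinear; tlift_pure and tens_ext give the universal property.          *)
Section TensorPower.
Variables (k : fieldType) (V : vectType k).

Local Notation e := (vbasis {:V}).

Definition tens (n : nat) : Type := {ffun n.-tuple 'I_(\dim {:V}) -> k^o}.

Definition tpure (n : nat) (s : seq V) : tens n :=
  [ffun t : n.-tuple _ => \prod_(i < n) coord e (tnth t i) s`_i].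

Definition tlift_fun (W : vectType k) (n : nat) (F : seq V -> W)
    (t : tens n) : W :=
  \sum_(i : n.-tuple 'I_(\dim {:V})) t i *: F [seq e`_(j : 'I__) | j <- i].

Fact tlift_fun_is_linear (W : vectType k) n (F : seq V -> W) :
  linear (@tlift_fun W n F).
Proof.
move=> a t u; rewrite /tlift_fun scaler_sumr -big_split /=.
apply: eq_bigr => i _; by rewrite !ffunE scalerDl scalerA.
Qed.
HB.instance Definition _ (W : vectType k) n (F : seq V -> W) :=
  GRing.isLinear.Build k (tens n) W _ (@tlift_fun W n F)
    (@tlift_fun_is_linear W n F).

Definition tlift (W : vectType k) (n : nat) (F : seq V -> W) :
    'Hom(tens n, W) :=
  linfun (@tlift_fun W n F).

Definition multilin (W : vectType k) (n : nat) (F : seq V -> W) : Prop :=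
  forall (s1 s2 : seq V) (a : k) (v w : V), (size s1 + size s2).+1 = n ->
    F (s1 ++ (a *: v + w) :: s2) = a *: F (s1 ++ v :: s2) + F (s1 ++ w :: s2).

Lemma tlift_pure (W : vectType k) n (F : seq V -> W) (s : seq V) :
  multilin n F -> size s = n -> tlift n F (tpure n s) = F s.
Proof.
move=> mF sz; move: sz mF => <- mF; rewrite /tlift lfunE /= /tlift_fun.
elim: s F mF => [|v s IHs] F multF /=.
  rewrite (big_pred1 [tuple]) => [|t]; last by apply/esym/eqP/tuple0.
  by rewrite ffunE big_ord0 scale1r.
have linF : linear (fun w => F (w :: s)).
  by move=> a x y; exact: (multF [::] s a x y (erefl _)).
pose F1 := GRing.isLinear.Build k V W _ (fun w => F (w :: s)) linF.
pose L : {linear V -> W} := HB.pack (fun w : V => F (w :: s)) F1.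
have -> : F (v :: s) = \sum_i coord e i v *: F (e`_i :: s).
  transitivity (L v) => //.
  rewrite {1}(coord_vbasis (memvf v)) linear_sum.
  by apply: eq_bigr => i _; rewrite linearZ.
under [RHS]eq_bigr => i _.
  rewrite -(IHs (fun s => F (e`_i :: s))); last first.
    move=> s1 s2 a x y sz12; apply: (multF (e`_i :: s1) s2).
    by rewrite /= addSn sz12.
  rewrite scaler_sumr; over.
rewrite pair_big /=.
pose h (t : (size s).+1.-tuple 'I_(\dim {:V})) :=
  (thead t, [tuple of behead t]).
pose g (p : 'I_(\dim {:V}) * (size s).-tuple 'I_(\dim {:V})) :=
  [tuple of p.1 :: p.2].
rewrite (reindex g) /=; last first.
  exists h => [[i t] _|t _]; last by rewrite /g /h /= [RHS]tuple_eta.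
  by rewrite /h /g /= theadE; congr pair; apply: val_inj.
apply: eq_bigr => -[i t] _ /=.
rewrite scalerA !ffunE big_ord_recl /= tnth0; congr (_ * _ *: _).
by apply: eq_bigr => j _; rewrite tnthS.
Qed.

Lemma tens_ext (W : vectType k) n (f g : 'Hom(tens n, W)) :
  (forall s, size s = n -> f (tpure n s) = g (tpure n s)) -> f = g.
Proof.
move=> eqfg; apply/lfunP => t.
have -> : t = \sum_(i : n.-tuple _) t i *: tpure n [seq e`_(j : 'I__) | j <- i].
  apply/ffunP => i; rewrite sum_ffunE (bigD1 i) //= big1 => [|j ji].
    rewrite addr0 !ffunE big1 ?[RHS]mulr1 // => l _.
    rewrite (nth_map (tnth i l)) ?size_tuple // -(tnth_nth (tnth i l)).
    by rewrite coord_free ?eqxx // (basis_free (vbasisP _)).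
  rewrite !ffunE; have [l jl] : exists l, tnth j l != tnth i l.
    by apply/existsP; apply: contraR ji => /existsPn ji;
       apply/eqP/eq_from_tnth => l; apply/eqP; move: (ji l); rewrite negbK.
  rewrite (bigD1 l) //= (nth_map (tnth j l)) ?size_tuple //.
  rewrite -(tnth_nth (tnth j l)).
  rewrite coord_free ?(basis_free (vbasisP _)) // eq_sym.
  by rewrite eq_sym (negPf jl) mul0r; apply: mulr0.
rewrite !linear_sum; apply: eq_bigr => i _; rewrite 2!linearZ /= eqfg //.
by rewrite size_map size_tuple.
Qed.

End TensorPower.

Section Hochschild.
Variables (k : fieldType) (A : falgType k).

(* [:: a_0; ..; a_n] |-> [:: a_0; ..; a_i a_(i+1); ..; a_n] *)
Definition merge_at (i : nat) (s : seq A) : seq A :=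
  take i s ++ (s`_i * s`_i.+1) :: drop i.+2 s.

(* A^e = A (x) A^op has underlying space tens A 2; the structures of         *)
(* A^e-module used are (a (x) b) . t = a t b on tens A n.+2 (for n = 0 this  *)
(* is the product of A^e) and (a (x) b) . c = a c b on A.                    *)
Definition ends_mul n (a b : A) : 'End(tens A n.+2) :=
  tlift n.+2 (fun s =>
    tpure n.+2 (a * s`_0 :: rcons (take n (behead s)) (s`_n.+1 * b))).

Definition env_act n (u : tens A 2) (t : tens A n.+2) : tens A n.+2 :=
  tlift 2 (fun s => ends_mul n s`_0 s`_1 t) u.

(* u |-> u . c, the A^e-linear map A^e -> A with 1 (x) 1 |-> c *)
Definition env_orbit (c : A) : 'Hom(tens A 2, A) :=
  tlift 2 (fun s => s`_0 * c * s`_1).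

Lemma env_orbit_pure (c a b : A) : env_orbit c (tpure 2 [:: a; b]) = a * c * b.
Proof.
rewrite /env_orbit tlift_pure // => -[|? [|? ?]] [|? [|? ?]] //.
  by move=> z v w _ /=; rewrite !mulrDl -!scalerAl.
by move=> z v w _ /=; rewrite mulrDr -scalerAr.
Qed.

Lemma env_orbit_linear (c : A) (u t : tens A 2) :
  env_orbit c (env_act (n := 0) u t)
    = tlift 2 (fun s => s`_0 * env_orbit c t * s`_1) u.
Proof.
have E a b : (env_orbit c \o ends_mul 0 a b
    = amulr b \o (amull a \o env_orbit c))%VF.
  apply: tens_ext => -[|a' [|b' []]] // _.
  rewrite !comp_lfunE [amulr b _]lfunE [amull a _]lfunE /= env_orbit_pure.
  rewrite tlift_pure /= ?env_orbit_pure ?mulrA //.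
  move=> -[|? [|? ?]] [|? [|? ?]] //.
    move=> z v w _; apply/ffunP => i; rewrite !ffunE /= !big_ord_recl !big_ord0.
    by rewrite /= mulrDr -scalerAr linearP /= !mulrDl !scalerAl.
  move=> z v w _; apply/ffunP => i; rewrite !ffunE /= !big_ord_recl !big_ord0.
  by rewrite /= mulrDl -scalerAl linearP /= !mulr1 mulrDr scalerAr.
rewrite /env_act ![tlift 2 _ u]lfunE /= /tlift_fun linear_sum.
apply: eq_bigr => i _; rewrite linearZ /=; congr (_ *: _).
by rewrite -comp_lfunE E !comp_lfunE [amulr _ _]lfunE [amull _ _]lfunE.
Qed.

Definition augmentation : 'Hom(tens A 2, A) := tlift 2 (fun s => s`_0 * s`_1).

Definition bar (n : nat) := tens A n.+2.

Definition bar_diff n : 'Hom(bar n.+1, bar n) :=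
  tlift n.+3 (fun s => \sum_(i < n.+2) (-1) ^+ i *: tpure n.+2 (merge_at i s)).

Definition cochain (n : nat) := 'Hom(tens A n, A).

Definition hoch_diff_fun n (f : cochain n) : cochain n.+1 :=
  tlift n.+1 (fun s => s`_0 * f (tpure n (behead s))
    + \sum_(i < n) (-1) ^+ i.+1 *: f (tpure n (merge_at i s))
    + (-1) ^+ n.+1 *: (f (tpure n (take n s)) * s`_n)).

Fact hoch_diff_fun_is_linear n : linear (@hoch_diff_fun n).
Proof.
have scaleC (a b : k) (v : A) : a *: (b *: v) = b *: (a *: v).
  by rewrite !scalerA mulrC.
move=> a f g; apply/lfunP => t; rewrite add_lfunE scale_lfunE !lfunE /=.
rewrite /tlift_fun scaler_sumr -big_split /=; apply: eq_bigr => i _.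
rewrite scaleC -scalerDr; congr (_ *: _).
rewrite !scalerDr !add_lfunE !scale_lfunE mulrDr mulrDl scalerDr.
rewrite -scalerAr -scalerAl.
rewrite (scaleC _ a) scaler_sumr.
under eq_bigr do rewrite add_lfunE scale_lfunE scalerDr scaleC.
by rewrite big_split /= (addrACA (a *: _)) [LHS]addrACA.
Qed.
HB.instance Definition _ n :=
  GRing.isLinear.Build k (cochain n) (cochain n.+1) _
    (@hoch_diff_fun n) (@hoch_diff_fun_is_linear n).

Definition hoch_diff n : 'Hom(cochain n, cochain n.+1) :=
  linfun (@hoch_diff_fun n).

Definition cocycles n : {vspace cochain n} := lker (hoch_diff n).

Definition coboundaries n : {vspace cochain n} :=
  if n is m.+1 then limg (hoch_diff m) else 0%VS.

Definition HH (n : nat) := {ideal_quot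
  (linfun (@vsval _ _ (cocycles n)) @^-1: coboundaries n)%VS}.

(* vsproj is the identity on cocycles *)
Definition HH_class n (f : cochain n) : HH n :=
  (\pi_(HH n) (vsproj (cocycles n) f))%qT.

(* the sign exponent is that of (-1) ^ ((n - 1) i), i counted from 0 *)
Definition circ m n (f : cochain m) (g : cochain n) (s : seq A) : A :=
  \sum_(i < m) (-1) ^+ (n.+1 * i) *:
    f (tpure m (take i s ++ g (tpure n (take n (drop i s))) :: drop (i + n) s)).

Definition bracket m n (f : cochain m) (g : cochain n) : cochain (m + n).-1 :=
  tlift (m + n).-1 (fun s => circ f g s - (-1) ^+ (m.+1 * n.+1) *: circ g f s).

(* repr picks representing cocycles; the result does not depend on the choice *)
Definition HH_bracket m n (c : HH m) (d : HH n) : HH (m + n).-1 :=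
  HH_class (bracket (vsval (repr c)) (vsval (repr d))).

(* the isomorphism Hom_(A^e)(bar n, A) = Hom_k(A^(x)n, A) *)
Definition bar_restrict n (F : 'Hom(bar n, A)) : cochain n :=
  tlift n (fun s => F (tpure n.+2 (1 :: rcons s 1))).

End Hochschild.

HB.instance Definition _ (k : fieldType) (h : {poly k}) :=
  Vector.on {poly %/ h}.

Section TruncatedPoly.
Variables (k : fieldType) (p : nat).

Definition truncpoly : falgType k := {poly %/ ('X^p : {poly k})}.

Local Notation A := truncpoly.

Definition xA : A := 'qX.

Definition per (n : nat) := tens A 2.

Definition per_u : tens A 2 := tpure 2 [:: xA; 1] - tpure 2 [:: 1; xA].

Definition per_v : tens A 2 :=
  \sum_(i < p) tpure 2 [:: xA ^+ (p.-1 - i); xA ^+ i].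

Definition per_diff n (t : per n.+1) : per n :=
  env_act (n := 0) (if odd n.+1 then per_u else per_v) t.

Definition xi_dual n (j : nat) : 'Hom(per n, A) := env_orbit (xA ^+ j).

(* A^e-linear chain maps from the bar to the periodic resolution over id_A *)
Definition comparison_map (Psi : forall n, 'Hom(bar A n, per n)) : Prop :=
  [/\ forall n (a : tens A 2) (t : bar A n),
        Psi n (env_act a t) = env_act (n := 0) a (Psi n t),
      forall t : bar A 0, augmentation A (Psi 0 t) = augmentation A t
    & forall n (t : bar A n.+1),
        per_diff (n := n) (Psi n.+1 t) = Psi n (bar_diff A n t)].

Definition xi_class (Psi : forall n, 'Hom(bar A n, per n)) n (j : nat) :
    HH A n :=
  HH_class (bar_restrict (xi_dual n j \o Psi n)%VF).

End TruncatedPoly.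

(* Main.v *)
(* A class of degree 1 is a derivation of A = k[x]/(x^p), determined by its   *)
(* value on x.  In degree 2, a cocycle g is a coboundary as soon as x kills   *)
(* [cycle_eval g], its value at the 2-cycle                                   *)
(* sum_l 1 (x) x^l (x) x (x) x^(p-1-l), which a comparison map Psi sends to   *)
(* an element of A^e acting on x A as 1.  Hence g is cohomologous to c times  *)
(* the carry cocycle (a, b) |-> quotient of the product of the lifts of a and *)
(* b by X^p, with c = cycle_eval g.  The brackets of derivations and carry    *)
(* cocycles are computed with polynomial division by X^p.                     *)

From HB Require Import structures.
Require Import Defs.
From mathcomp Require Import all_boot all_algebra falgebra ring zify.

Set Implicit Arguments.
Unset Strict Implicit.
Unset Printing Implicit Defensive.

Import GRing.Theory.
Local Open Scope ring_scope.

(** In degree 1, [A] being commutative, inner derivations vanish and a class is a derivation. The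
    cochain [xi_cochain 1 i] is the vector field [x^i d/dx], and the first formula is the Lie
    bracket of vector fields ([bracket_xi11]).

    In degree 2, a class is an infinitesimal deformation [x^p = t c(x)], with cocycle
    [carry_cochain c]. It depends only on [x c], that is, on [c] modulo the ideal of [x^(p-1)]
    ([sub_carry_coboundary], resting on [cycle_eval_coboundary], where characteristic 0 allows
    division by [p]). For an arbitrary comparison map, the chain map equations at 1 (x) x (x) 1 and
    at the 2-cycle of [cycle_eval] show that [xi_cochain 2 j] has [c = x^j] ([cycle_eval_xi]).

    A derivation [f] with [f x = x y] lifts to [D = y X d/dX] on polynomials, and
    [D(X^p) = p y X^p]. Comparing quotients by [X^p] gives the class of [[f, carry_cochain c]] as
    that of [carry_cochain (f c - p y c)] ([bracket12_carry]); with [y = x^(i-1)] and [c = x^j] the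
    coefficient is [(j - p) x^(i+j-1)]. Two degree 2 deformations sit in the two-parameter family
    [x^p = s f(x) + t g(x)], and the [s t] part of its associativity exhibits the bracket of their
    cocycles as a coboundary ([bracket_carry_cochain]).

    Bracketing a coboundary with a cocycle gives a coboundary in the degrees concerned
    ([bracket_hoch_diff12], [bracket_hoch_diff22]), so the computations may be made on these
    representatives. *)

Section Multilinear.
Variables (k : fieldType) (V : vectType k).
Implicit Types (s : seq V).

(** * Multilinear functions of sequences *)

Lemma drop_catl n s1 s2 :
  (n <= size s1)%N -> drop n (s1 ++ s2) = drop n s1 ++ s2.
Proof.
by rewrite drop_cat; case: ltngtP => // ->; rewrite subnn drop0 drop_size.
Qed.

Lemma multilin_tpure n : multilin n (@tpure k V n).
Proof.
move=> s1 s2 a v w sz; apply/ffunP => t; rewrite !ffunE.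
have lt1 : (size s1 < n)%N by rewrite -sz ltnS leq_addr.
pose c u (i : 'I_n) := coord (vbasis {:V}) (tnth t i) (s1 ++ u :: s2)`_i.
have cE u : \prod_(i < n) c u i = coord (vbasis {:V}) (tnth t (Ordinal lt1)) u
    * \prod_(i < n | i != Ordinal lt1) c 0 i.
  rewrite (bigD1 (Ordinal lt1)) //= {1}/c nth_cat ltnn subnn; congr (_ * _).
  apply: eq_bigr => i; rewrite -val_eqE /= => ni; congr (coord _ _ _).
  rewrite !nth_cat; case: ltnP => // le1i.
  have : (0 < i - size s1)%N by rewrite subn_gt0 ltn_neqAle eq_sym ni.
  by case: (i - size s1)%N.
by rewrite !cE linearP /= mulrDl -mulrA.
Qed.

Section Closure.
Variable W : vectType k.
Implicit Types F G : seq V -> W.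

Lemma eq_multilin n F G :
  (forall s, size s = n -> F s = G s) -> multilin n F -> multilin n G.
Proof.
by move=> E mF s1 s2 a v w sz; rewrite -!E ?mF // size_cat /= addnS.
Qed.

Lemma multilin_comp (W' : vectType k) (f : {linear W -> W'}) n F :
  multilin n F -> multilin n (fun s => f (F s)).
Proof. by move=> mF s1 s2 a v w sz; rewrite mF // linearP. Qed.

Lemma multilin_add n F G :
  multilin n F -> multilin n G -> multilin n (fun s => F s + G s).
Proof.
by move=> mF mG s1 s2 a v w sz; rewrite mF // mG // scalerDr addrACA.
Qed.

Lemma multilin_scale n (c : k) F :
  multilin n F -> multilin n (fun s => c *: F s).
Proof. exact: (multilin_comp ( *:%R c)). Qed.

Lemma multilin_sum n (I : finType) (F : I -> seq V -> W) :
  (forall i, multilin n (F i)) -> multilin n (fun s => \sum_i F i s).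
Proof.
move=> mF s1 s2 a v w sz; rewrite scaler_sumr -big_split /=.
by apply: eq_bigr => i _; apply: mF.
Qed.

(** This is the shape of one term of a circle product, and also of merging two neighbours or acting
    on one entry. The cases are whether the varied entry lies before, inside or after the block fed
    to [G]. *)
Lemma multilin_insert m n i F (G : seq V -> V) : (i < m)%N ->
  multilin m F -> multilin n G ->
  multilin (m + n).-1
    (fun s => F (take i s ++ G (take n (drop i s)) :: drop (i + n) s)).
Proof.
move=> lt_im mF mG s1 s2 a v w sz.
case: (ltnP (size s1) i) => [lt1i|le_i1].
  have [j ij] : exists j, i = (size s1 + j.+1)%N.
    by exists (i - size s1).-1; lia.
  have E u : take i (s1 ++ u :: s2) ++
      G (take n (drop i (s1 ++ u :: s2))) :: drop (i + n) (s1 ++ u :: s2) =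
      s1 ++ u :: (take j s2 ++ G (take n (drop j s2)) :: drop (j + n) s2).
    rewrite ij -addnA addSn !take_cat !drop_cat !ltnNge !leq_addr /=.
    by rewrite !addKn /= -catA.
  by rewrite !E mF // size_cat /= size_takel ?size_drop; lia.
case: (ltnP (size s1) (i + n)) => [lt1in|le_in1].
  have [j jE] : exists j, (i + n = size s1 + j.+1)%N.
    by exists (i + n - size s1).-1; lia.
  have E u : take i (s1 ++ u :: s2) ++
      G (take n (drop i (s1 ++ u :: s2))) :: drop (i + n) (s1 ++ u :: s2) =
      take i s1 ++ G (drop i s1 ++ u :: take j s2) :: drop j s2.
    have nE : n = (size s1 - i + j.+1)%N by lia.
    rewrite jE [drop (_ + _) _]drop_cat ltnNge leq_addr /= addKn /=.
    rewrite nE; congr (_ ++ G _ :: _).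
      by rewrite takel_cat.
    by rewrite drop_catl // take_cat size_drop ltnNge leq_addr /= addKn.
  rewrite !E mG; last by rewrite size_drop size_takel; lia.
  by rewrite mF // size_takel // size_drop; lia.
have E u : take i (s1 ++ u :: s2) ++
    G (take n (drop i (s1 ++ u :: s2))) :: drop (i + n) (s1 ++ u :: s2) =
    (take i s1 ++ G (take n (drop i s1)) :: drop (i + n) s1) ++ u :: s2.
  rewrite takel_cat // drop_catl // takel_cat ?size_drop; last by lia.
  by rewrite drop_catl // -catA.
by rewrite !E mF // size_cat /= size_takel // size_drop; lia.
Qed.
End Closure.
End Multilinear.

(** * Values of the structure maps on pure tensors *)

Section Evaluation.
Variables (k : fieldType) (A : falgType k).
Implicit Types (s : seq A) (a b c : A).

Lemma multilin_head : multilin 1 (fun s => s`_0).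
Proof. by move=> [|? ?] [|? ?]. Qed.

Lemma multilin_mul m n (F G : seq A -> A) : multilin m F -> multilin n G ->
  multilin (m + n) (fun s => F (take m s) * G (drop m s)).
Proof.
move=> mF mG s1 s2 a v w sz.
case: (ltnP (size s1) m) => [lt1m|le_m1].
  have [j mE] : exists j, m = (size s1 + j.+1)%N by exists (m - size s1).-1; lia.
  rewrite mE !take_cat !drop_cat !ltnNge !leq_addr /= !addKn /=.
  by rewrite mF ?mulrDl ?scalerAl // size_takel; lia.
rewrite !takel_cat // !drop_catl //.
by rewrite mG ?mulrDr ?scalerAr // size_drop; lia.
Qed.

Lemma multilin_hom (W : vectType k) n (f : 'Hom(tens A n, W)) :
  multilin n (fun s => f (tpure n s)).
Proof. exact: (multilin_comp f (multilin_tpure (n := n))). Qed.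

Lemma multilin_merge (W : vectType k) n i (F : seq A -> W) :
  (i < n)%N -> multilin n F -> multilin n.+1 (fun s => F (merge_at i s)).
Proof.
(* The arity is brought to the form [(n + 2).-1], that of inserting the binary product at place
   [i]. *)
move=> lt_in mF; rewrite -(addnK 1%N n.+1) subn1 addn1 -addn2.
have mG : multilin 2 (fun s => s`_0 * s`_1).
  apply: eq_multilin (multilin_mul multilin_head multilin_head).
  by case=> [|x [|y []]].
apply: eq_multilin (multilin_insert lt_in mF mG) => s sz.
by rewrite /merge_at !nth_take // !nth_drop addn0 addn1 addn2.
Qed.

Lemma hoch_diff_pure n (f : cochain A n) s : size s = n.+1 ->
  hoch_diff A n f (tpure n.+1 s) = s`_0 * f (tpure n (behead s))
    + \sum_(i < n) (-1) ^+ i.+1 *: f (tpure n (merge_at i s))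
    + (-1) ^+ n.+1 *: (f (tpure n (take n s)) * s`_n).
Proof.
move=> sz; rewrite /hoch_diff lfunE /= /hoch_diff_fun tlift_pure //.
have mf := multilin_hom f.
apply: multilin_add; first apply: multilin_add.
- apply: eq_multilin (multilin_mul multilin_head mf) => {sz} s sz.
  by rewrite nth_take // drop1.
- apply: multilin_sum => i; apply: multilin_scale.
  exact: (multilin_merge (ltn_ord i) mf).
- apply: multilin_scale.
  have := multilin_mul mf multilin_head; rewrite addn1.
  by apply: eq_multilin => {sz} s sz; rewrite nth_drop addn0.
Qed.

Lemma bar_diff_pure n s : size s = n.+3 ->
  bar_diff A n (tpure n.+3 s)
    = \sum_(i < n.+2) (-1) ^+ i *: tpure n.+2 (merge_at i s).
Proof.
move=> sz; rewrite /bar_diff tlift_pure //.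
apply: multilin_sum => i; apply: multilin_scale.
exact: (multilin_merge (ltn_ord i) (multilin_tpure (n := n.+2))).
Qed.

Lemma multilin_circ m n (f : cochain A m) (g : cochain A n) :
  multilin (m + n).-1 (circ f g).
Proof.
apply: multilin_sum => i; apply: multilin_scale.
exact: (multilin_insert (ltn_ord i) (multilin_hom f) (multilin_hom g)).
Qed.

Lemma bracket_pure m n (f : cochain A m) (g : cochain A n) s :
  size s = (m + n).-1 ->
  bracket f g (tpure (m + n).-1 s)
    = circ f g s - (-1) ^+ (m.+1 * n.+1) *: circ g f s.
Proof.
move=> sz; rewrite /bracket tlift_pure //.
apply: multilin_add; first exact: multilin_circ.
apply: (multilin_comp (-%R)); apply: multilin_scale.
by rewrite addnC; apply: multilin_circ.
Qed.

Lemma bar_restrict_pure n (F : 'Hom(bar A n, A)) s : size s = n ->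
  bar_restrict F (tpure n s) = F (tpure n.+2 (1 :: rcons s 1)).
Proof.
move=> sz; rewrite /bar_restrict tlift_pure // => s1 s2 a v w sz12.
rewrite !rcons_cat /= -!cat_cons.
by rewrite (multilin_hom F) //= size_rcons addnS addSn sz12.
Qed.

Lemma augmentation_pure a b : augmentation A (tpure 2 [:: a; b]) = a * b.
Proof.
rewrite /augmentation tlift_pure //.
apply: eq_multilin (multilin_mul multilin_head multilin_head).
by case=> [|x [|y []]].
Qed.

Lemma ends_mul_pure n a b c c' s : size s = n ->
  ends_mul n a b (tpure n.+2 (c :: rcons s c'))
    = tpure n.+2 (a * c :: rcons s (c' * b)).
Proof.
have takeE (t : seq A) y : size t = n -> take n (rcons t y) = t.
  by move=> <-; rewrite -cats1 takel_cat // take_size.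
move=> sz; rewrite /ends_mul tlift_pure /= ?size_rcons ?sz //; last first.
  have mul1 (L : {linear A -> A}) : multilin 1 (fun s => L s`_0).
    exact: (multilin_comp L multilin_head).
  have mt := @multilin_tpure _ A n.+2.
  (* The action is two unary insertions: left multiplication by [a] at place 0, right multiplication
     by [b] at place [n.+1]. *)
  have m1 := multilin_insert (ltn0Sn n.+1) mt (mul1 (amull a)).
  rewrite addn1 /= in m1.
  have m2 := multilin_insert (ltnSn n.+1) m1 (mul1 (amulr b)).
  rewrite addn1 /= in m2.
  apply: eq_multilin m2 => -[|x t] //= [szt].
  case/lastP: t szt => [|t y] //; rewrite size_rcons => -[szt].
  rewrite takeE // nth_rcons szt ltnn eqxx drop0 -cats1 drop_catl ?szt //.
  rewrite -szt drop_size addn1 drop_oversize ?size_cat ?addn1 //= cats1.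
  by rewrite [amull _ _]lfunE [amulr _ _]lfunE.
by rewrite takeE // nth_rcons sz ltnn eqxx.
Qed.

Lemma seq_ends n (s : seq A) : size s = n.+2 ->
  exists x m y, s = x :: rcons m y /\ size m = n.
Proof.
case: s => [|x s] //= [sz]; case/lastP: s sz => [|m y] //.
by rewrite size_rcons => -[sz]; exists x, m, y.
Qed.

Lemma ends_mul_linearl n b (l : k) a a' :
  ends_mul n (l *: a + a') b = l *: ends_mul n a b + ends_mul n a' b.
Proof.
apply: tens_ext => s /seq_ends[x [m [y [-> sz]]]].
rewrite add_lfunE scale_lfunE !ends_mul_pure // mulrDl -scalerAl.
by rewrite (multilin_tpure (s1 := [::])) //= size_rcons sz.
Qed.

Lemma ends_mul_linearr n a (l : k) b b' :
  ends_mul n a (l *: b + b') = l *: ends_mul n a b + ends_mul n a b'.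
Proof.
apply: tens_ext => s /seq_ends[x [m [y [-> sz]]]].
rewrite add_lfunE scale_lfunE !ends_mul_pure // mulrDr -scalerAr.
by rewrite -!cats1 -!cat_cons multilin_tpure //= addn0 sz.
Qed.

Lemma env_act_pure n a b (t : tens A n.+2) :
  env_act (tpure 2 [:: a; b]) t = ends_mul n a b t.
Proof.
rewrite /env_act tlift_pure // => -[|x [|? ?]] [|y [|? ?]] // l v w _ /=.
  by rewrite ends_mul_linearl add_lfunE scale_lfunE.
by rewrite ends_mul_linearr add_lfunE scale_lfunE.
Qed.

Lemma env_act_linear n l (u u' : tens A 2) (t : tens A n.+2) :
  env_act (l *: u + u') t = l *: env_act u t + env_act u' t.
Proof. exact: linearP. Qed.
End Evaluation.

(** * Classes and their representatives *)

Section CohomologyClasses.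
Variables (k : fieldType) (A : falgType k) (n : nat).
Implicit Types (f g : cochain A n) (c : HH A n).

Lemma cocycle_repr c : vsval (repr c) \in cocycles A n.
Proof. exact: subvsP. Qed.

Lemma HH_class_eqP f g : f \in cocycles A n -> g \in cocycles A n ->
  reflect (HH_class f = HH_class g) (f - g \in coboundaries A n).
Proof.
move=> Zf Zg; suff -> : (f - g \in coboundaries A n) = (HH_class f == HH_class g).
  exact: eqP.
rewrite /HH_class -Quotient.idealrBE.
by rewrite -memv_preim lfunE /= !vsprojK.
Qed.

(** [HH_bracket] evaluates on chosen representatives; this controls the choice. *)
Lemma repr_HH_class f : f \in cocycles A n ->
  vsval (repr (HH_class f)) - f \in coboundaries A n.
Proof.
move=> Zf; apply/HH_class_eqP => //; first exact: cocycle_repr.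
by rewrite {1}/HH_class vsvalK reprK.
Qed.

Lemma HH_classMz f m : HH_class (f *~ m) = HH_class f *~ m.
Proof. rewrite /HH_class raddfMz; exact: raddfMz. Qed.

Lemma HH_class_eq0 f : f \in cocycles A n -> f \in coboundaries A n ->
  HH_class f = 0.
Proof.
(* Zero is written as the class of [f *~ 0], so that the criterion for equality of two classes
   applies. *)
move=> Zf Bf; rewrite -[RHS](mulr0z (HH_class f)) -HH_classMz mulr0z.
by apply/HH_class_eqP; rewrite ?subr0 // mem0v.
Qed.

End CohomologyClasses.

Local Notation ev1 f a := (f (tpure 1 [:: a])).
Local Notation ev2 f a b := (f (tpure 2 [:: a; b])).
Local Notation ev3 f a b c := (f (tpure 3 [:: a; b; c])).

(** * Differentials, brackets and cocycles in degrees at most 3 *)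

Section LowDegree.
Variables (k : fieldType) (A : falgType k).
Implicit Types (a b c d : A).

Lemma scale_signr (V : lmodType k) n (v : V) :
  (-1) ^+ n *: v = if odd n then - v else v.
Proof. by rewrite -signr_odd; case: odd; rewrite (scale1r, scaleN1r). Qed.

Lemma ev1_linear (W : vectType k) (f : 'Hom(tens A 1, W)) :
  linear (fun a => ev1 f a).
Proof. by move=> l a b; exact: (multilin_hom f (s1 := [::]) (s2 := [::])). Qed.

Lemma ev2_linearl (W : vectType k) (f : 'Hom(tens A 2, W)) b :
  linear (fun a => ev2 f a b).
Proof.
by move=> l a a'; exact: (multilin_hom f (s1 := [::]) (s2 := [:: b])).
Qed.

Lemma ev2_linearr (W : vectType k) (f : 'Hom(tens A 2, W)) a :
  linear (fun b => ev2 f a b).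
Proof.
by move=> l b b'; exact: (multilin_hom f (s1 := [:: a]) (s2 := [::])).
Qed.

Lemma ev1D (f : cochain A 1) a b : ev1 f (a + b) = ev1 f a + ev1 f b.
Proof. by have [_] := GRing.semilinear_linear (ev1_linear f); apply. Qed.

Lemma ev1B (f : cochain A 1) a b : ev1 f (a - b) = ev1 f a - ev1 f b.
Proof. exact: (GRing.zmod_morphism_linear (ev1_linear f)). Qed.

Lemma ev2Dl (f : cochain A 2) a b c : ev2 f (a + b) c = ev2 f a c + ev2 f b c.
Proof. by have [_] := GRing.semilinear_linear (ev2_linearl f c); apply. Qed.

Lemma ev2Bl (f : cochain A 2) a b c : ev2 f (a - b) c = ev2 f a c - ev2 f b c.
Proof. exact: (GRing.zmod_morphism_linear (ev2_linearl f c)). Qed.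

Lemma ev2Dr (f : cochain A 2) a b c : ev2 f a (b + c) = ev2 f a b + ev2 f a c.
Proof. by have [_] := GRing.semilinear_linear (ev2_linearr f a); apply. Qed.

Lemma ev2Br (f : cochain A 2) a b c : ev2 f a (b - c) = ev2 f a b - ev2 f a c.
Proof. exact: (GRing.zmod_morphism_linear (ev2_linearr f a)). Qed.

Lemma cochain_ext1 (f g : cochain A 1) :
  (forall a, ev1 f a = ev1 g a) -> f = g.
Proof. by move=> E; apply: tens_ext => -[|a []]. Qed.

Lemma cochain_ext2 (f g : cochain A 2) :
  (forall a b, ev2 f a b = ev2 g a b) -> f = g.
Proof. by move=> E; apply: tens_ext => -[|a [|b []]]. Qed.

Lemma cochain_ext3 (f g : cochain A 3) :
  (forall a b c, ev3 f a b c = ev3 g a b c) -> f = g.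
Proof. by move=> E; apply: tens_ext => -[|a [|b [|c []]]]. Qed.

Lemma hoch_diff1E (f : cochain A 1) a b :
  ev2 (hoch_diff A 1 f) a b = a * ev1 f b - ev1 f (a * b) + ev1 f a * b.
Proof. by rewrite hoch_diff_pure // big_ord1 !scale_signr. Qed.

Lemma hoch_diff2E (f : cochain A 2) a b c :
  ev3 (hoch_diff A 2 f) a b c
    = a * ev2 f b c - ev2 f (a * b) c + ev2 f a (b * c) - ev2 f a b * c.
Proof.
by rewrite hoch_diff_pure // !big_ord_recl big_ord0 !scale_signr /= addr0 addrA.
Qed.

Lemma hoch_diff3E (f : cochain A 3) a b c d :
  hoch_diff A 3 f (tpure 4 [:: a; b; c; d])
    = a * ev3 f b c d - ev3 f (a * b) c d + ev3 f a (b * c) d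
      - ev3 f a b (c * d) + ev3 f a b c * d.
Proof.
by rewrite hoch_diff_pure // !big_ord_recl big_ord0 !scale_signr /= addr0 !addrA.
Qed.

Lemma bracket11E (f g : cochain A 1) a :
  ev1 (bracket f g) a = ev1 f (ev1 g a) - ev1 g (ev1 f a).
Proof. by rewrite (bracket_pure f g) // /circ !big_ord1 !scale_signr. Qed.

Lemma bracket12E (f : cochain A 1) (g : cochain A 2) a b :
  ev2 (bracket f g) a b
    = ev1 f (ev2 g a b) - ev2 g (ev1 f a) b - ev2 g a (ev1 f b).
Proof.
rewrite (bracket_pure f g) // /circ !big_ord_recl !big_ord0 !scale_signr /=.
by rewrite !addr0 opprD addrA.
Qed.

Lemma bracket22E (f g : cochain A 2) a b c :
  ev3 (bracket f g) a b c
    = ev2 f (ev2 g a b) c - ev2 f a (ev2 g b c)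
      + (ev2 g (ev2 f a b) c - ev2 g a (ev2 f b c)).
Proof.
rewrite (bracket_pure f g) // /circ !big_ord_recl !big_ord0 !scale_signr /=.
by rewrite !addr0 opprK.
Qed.

Lemma cocycle1P (f : cochain A 1) :
  f \in cocycles A 1 <-> forall a b, ev1 f (a * b) = a * ev1 f b + ev1 f a * b.
Proof.
rewrite memv_ker; split=> [/eqP df a b|df].
  apply/esym/eqP; rewrite -subr_eq0 addrAC -hoch_diff1E df.
  by rewrite zero_lfunE.
apply/eqP/cochain_ext2 => a b; rewrite hoch_diff1E df zero_lfunE.
by rewrite addrAC subrr.
Qed.

Lemma cocycle2P (f : cochain A 2) :
  f \in cocycles A 2 <-> forall a b c,
    a * ev2 f b c - ev2 f (a * b) c + ev2 f a (b * c) - ev2 f a b * c = 0.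
Proof.
rewrite memv_ker; split=> [/eqP df a b c|df].
  by rewrite -hoch_diff2E df zero_lfunE.
by apply/eqP/cochain_ext3 => a b c; rewrite hoch_diff2E df zero_lfunE.
Qed.

End LowDegree.

(** * Compatibility of the bracket with the differential *)

Section Homotopies.
Variables (k : fieldType) (p : nat).
Local Notation A := (truncpoly k p).
Implicit Types (a b c d : A).

Lemma hoch_diff12 (f : cochain A 1) : hoch_diff A 1 f \in cocycles A 2.
Proof. by apply/cocycle2P => a b c; rewrite !hoch_diff1E !mulrA; ring. Qed.

Lemma hoch_diff23 (f : cochain A 2) : hoch_diff A 2 f \in cocycles A 3.
Proof.
rewrite memv_ker; apply/eqP/tens_ext => -[|a [|b [|c [|d []]]]] // _.
by rewrite hoch_diff3E zero_lfunE !hoch_diff2E !mulrA; ring.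
Qed.

Lemma coboundaries_sub_cocycles2 (f : cochain A 2) :
  f \in coboundaries A 2 -> f \in cocycles A 2.
Proof. by case/memv_imgP => h _ ->; apply: hoch_diff12. Qed.

Lemma coboundaries_sub_cocycles3 (f : cochain A 3) :
  f \in coboundaries A 3 -> f \in cocycles A 3.
Proof. by case/memv_imgP => h _ ->; apply: hoch_diff23. Qed.

(** It makes the class of the bracket with a derivation independent of the representative in degree
    2. *)
Lemma bracket_hoch_diff12 (f h : cochain A 1) : f \in cocycles A 1 ->
  bracket f (hoch_diff A 1 h) = hoch_diff A 1 (bracket f h).
Proof.
move/cocycle1P => df; apply: cochain_ext2 => a b.
rewrite (bracket12E f (hoch_diff A 1 h)) !hoch_diff1E.
rewrite !(bracket11E f h) !(ev1B, ev1D, df).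
by ring.
Qed.

(** Both arguments have odd shifted degree 1, so the graded commutator is symmetric. *)
Lemma bracket22_sym (f g : cochain A 2) : bracket f g = bracket g f.
Proof.
apply: cochain_ext3 => a b c.
apply: etrans (bracket22E f g a b c) _.
by apply: etrans _ (esym (bracket22E g f a b c)); apply: addrC.
Qed.

Lemma bracket_hoch_diff22 (h : cochain A 1) (g : cochain A 2) :
  g \in cocycles A 2 ->
  bracket (hoch_diff A 1 h) g = - hoch_diff A 2 (bracket h g).
Proof.
move/cocycle2P => dg; apply: cochain_ext3 => a b c.
(* The cocycle identity is solved for [g (xy, z)]. The four instances needed are its image under [h]
   and those with one argument replaced by its image under [h]. *)
have dgE x y z : x * ev2 g y z + ev2 g x (y * z) - ev2 g x y * z = ev2 g (x * y) z.
  by apply/eqP; rewrite -subr_eq0 -(dg x y z); apply/eqP; ring.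
rewrite (bracket22E (hoch_diff A 1 h) g) opp_lfunE hoch_diff2E !hoch_diff1E.
rewrite !(bracket12E h g) !(ev2Bl, ev2Br, ev2Dl, ev2Dr, ev1B, ev1D).
have hE := congr1 (fun x => ev1 h x) (dgE a b c).
rewrite /= !(ev1B, ev1D) in hE.
rewrite -hE -(dgE a b) -(dgE a (ev1 h b)) -(dgE (ev1 h a) b).
ring.
Qed.
End Homotopies.

Lemma multilin1 (k : fieldType) (V W : vectType k) (L : V -> W) :
  linear L -> multilin 1 (fun s => L s`_0).
Proof. by move=> linL [|? ?] [|? ?] // a v w _; apply: linL. Qed.

Lemma multilin2 (k : fieldType) (V W : vectType k) (B : V -> V -> W) :
  (forall b, linear (B^~ b)) -> (forall a, linear (B a)) ->
  multilin 2 (fun s => B s`_0 s`_1).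
Proof.
by move=> linl linr [|x [|? ?]] [|y [|? ?]] // a v w _ /=; rewrite (linl, linr).
Qed.

(** * Polynomial lifts and the carry cocycle *)

Section Truncation.
Variables (k : fieldType) (p : nat).
Hypothesis p_gt1 : (1 < p)%N.
Local Notation A := (truncpoly k p).
Local Notation x := (xA k p).
Implicit Types (a b c : A) (P Q : {poly k}).

Definition trunc P : A := in_qpoly 'X^p P.
Definition rep (a : A) : {poly k} := val (a : {poly %/ 'X^p : {poly k}}).

Lemma truncD P Q : trunc (P + Q) = trunc P + trunc Q.
Proof. exact: in_qpolyD. Qed.
Lemma truncM P Q : trunc (P * Q) = trunc P * trunc Q.
Proof. exact: in_qpolyM. Qed.
Lemma trunc0 : trunc 0 = 0.
Proof. exact: in_qpoly0. Qed.
Lemma trunc1 : trunc 1 = 1.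
Proof. exact: in_qpoly1. Qed.
Lemma truncZ l P : trunc (l *: P) = l *: trunc P.
Proof. exact: in_qpolyZ. Qed.
Lemma truncB P Q : trunc (P - Q) = trunc P - trunc Q.
Proof. by rewrite truncD -scaleN1r truncZ scaleN1r. Qed.
Lemma truncX n : trunc 'X^n = x ^+ n.
Proof. by elim: n => [|n IH]; rewrite ?trunc1 // !exprS truncM IH. Qed.
Lemma truncMn P n : trunc (P *+ n) = trunc P *+ n.
Proof. by rewrite -!scaler_nat truncZ. Qed.

Lemma repD a b : rep (a + b) = rep a + rep b.
Proof. by []. Qed.
Lemma repZ l a : rep (l *: a) = l *: rep a.
Proof. by []. Qed.

Lemma repE P : rep (trunc P) = take_poly p P.
Proof.
rewrite /rep /= mk_monic_Xn prednK ?(ltnW p_gt1) //.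
by rewrite Pdiv.RingMonic.take_poly_rmodp.
Qed.

Lemma size_rep a : (size (rep a) <= p)%N.
Proof.
apply: leq_trans (size_npoly (a : {poly %/ 'X^p : {poly k}})) _.
by rewrite mk_monic_Xn prednK ?(ltnW p_gt1) // size_polyXn.
Qed.

Lemma repK a : trunc (rep a) = a.
Proof. by apply: val_inj; rewrite [LHS]repE take_poly_id // size_rep. Qed.

Lemma xA_expr_ge n : (p <= n)%N -> x ^+ n = 0.
Proof.
move=> le_pn; rewrite -truncX -[trunc _]repK repE.
by rewrite -(subnK le_pn) exprD take_polyMXn_0 trunc0.
Qed.

Lemma rep_trunc P : rep (trunc P) = P - drop_poly p P * 'X^p.
Proof. by rewrite repE -{2}(poly_take_drop p P) addrK. Qed.

(** Reducing [P] subtracts an exact multiple of [X^p], so the quotient of the product changes by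
    exactly that multiplier times [Q]. *)
Lemma drop_rep_truncM P Q : drop_poly p (rep (trunc P) * Q)
  = drop_poly p (P * Q) - drop_poly p P * Q.
Proof.
by rewrite rep_trunc mulrBl linearB /= mulrAC drop_polyMXn_id.
Qed.

Lemma rep_xA n : (n < p)%N -> rep (x ^+ n) = 'X^n.
Proof. by move=> lt_np; rewrite -truncX repE take_poly_id // size_polyXn. Qed.

Lemma linear_eq0_xA (W : vectType k) (L : {linear A -> W}) :
  (forall n, (n < p)%N -> L (x ^+ n) = 0) -> forall a, L a = 0.
Proof.
move=> L0 a; rewrite -[a]repK -[rep a]coefK poly_def.
elim/big_rec: _ => [|i P _ LP].
  by rewrite trunc0 linear0.
rewrite truncD truncZ truncX linearP LP addr0.
case: (ltnP i p) => [/L0 ->|/xA_expr_ge ->]; rewrite ?linear0 ?scaler0 //.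
Qed.

(** The coefficient of [t] in the product of [a] and [b] in the deformation [x^p = t]. *)
Definition carry a b : A := trunc (drop_poly p (rep a * rep b)).

Lemma carry_linearl b : linear (carry^~ b).
Proof.
move=> l a a'; rewrite /carry repD repZ mulrDl -scalerAl.
by rewrite drop_polyD drop_polyZ truncD truncZ.
Qed.

Lemma carryC a b : carry a b = carry b a.
Proof. by rewrite /carry mulrC. Qed.

Lemma carry_truncl P b :
  carry (trunc P) b = trunc (drop_poly p (P * rep b)) - trunc (drop_poly p P) * b.
Proof. by rewrite /carry drop_rep_truncM truncB truncM repK. Qed.

(** The first term depends only on the product of the three lifts, hence cancels in the cocycle
    identity; the corrections cancel the outer terms. *)
Lemma carryMl a b c : carry (a * b) c
  = trunc (drop_poly p (rep a * rep b * rep c)) - carry a b * c.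
Proof. by rewrite -{1}(repK a) -{1}(repK b) -truncM carry_truncl. Qed.

Definition carry_cochain c : cochain A 2 :=
  tlift 2 (fun s => carry s`_0 s`_1 * c).

Lemma carry_cochainE c a b : ev2 (carry_cochain c) a b = carry a b * c.
Proof.
rewrite /carry_cochain tlift_pure //.
apply: (multilin2 (B := fun a b => carry a b * c)) => [{}b|{}a] l u v.
  by rewrite carry_linearl mulrDl -scalerAl.
by rewrite !(carryC a) carry_linearl mulrDl -scalerAl.
Qed.

Lemma carry_cochain_cocycle c : carry_cochain c \in cocycles A 2.
Proof.
apply/cocycle2P => a b d; rewrite !carry_cochainE (carryC a (b * d)) !carryMl.
have -> : rep b * rep d * rep a = rep a * rep b * rep d by ring.
ring.
Qed.

Lemma carry_cochainMz c m : carry_cochain (c *~ m) = carry_cochain c *~ m.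
Proof.
have add : zmod_morphism carry_cochain.
  move=> u v; apply: cochain_ext2 => a b.
  by rewrite add_lfunE opp_lfunE !carry_cochainE mulrBr.
pose F := GRing.isZmodMorphism.Build A (cochain A 2) carry_cochain add.
pose L : {additive A -> cochain A 2} := HB.pack carry_cochain F.
exact: (raddfMz L).
Qed.

(* The coefficient of [s t] in the multiplication of the two-parameter family *)
(* of algebras [k[x] / (x^p - s f(x) - t g(x))].                              *)
Definition carry_bracket_fun (f g a b : A) : A :=
  let r h := trunc (drop_poly p (drop_poly p (rep a * rep b) * rep h)) in
  r f * g + r g * f.

Definition carry_bracket (f g : A) : cochain A 2 :=
  tlift 2 (fun s => carry_bracket_fun f g s`_0 s`_1).

Lemma carry_bracketE f g a b :
  ev2 (carry_bracket f g) a b = carry_bracket_fun f g a b.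
Proof.
have lin c : linear (carry_bracket_fun f g ^~ c).
  move=> l u v; rewrite /carry_bracket_fun repD repZ !mulrDl -!scalerAl.
  rewrite !(drop_polyD, drop_polyZ) !mulrDl -!scalerAl !(drop_polyD, drop_polyZ).
  by rewrite !(truncD, truncZ) !mulrDl -!scalerAl scalerDr addrACA.
have sym u v : carry_bracket_fun f g u v = carry_bracket_fun f g v u.
  by rewrite /carry_bracket_fun (mulrC (rep u)).
rewrite /carry_bracket tlift_pure //.
by apply: multilin2 => // c l u v; rewrite !(sym c) lin.
Qed.

(** This is the coefficient of [s t] in the associativity of the two-parameter family. All terms
    become quotients of expressions in lifts, where the product of the three lifts is symmetric. *)
Lemma bracket_carry_cochain (f g : A) :
  bracket (carry_cochain f) (carry_cochain g)
    = hoch_diff A 2 (carry_bracket f g).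
Proof.
have carryMf u v w h : carry (carry u v * h) w
    = trunc (drop_poly p (drop_poly p (rep u * rep v) * rep h * rep w))
      - trunc (drop_poly p (drop_poly p (rep u * rep v) * rep h)) * w.
  by rewrite -{1}(repK h) -[carry u v]/(trunc _) -truncM carry_truncl.
have bracketM u v w : carry_bracket_fun f g (u * v) w =
    let r h := trunc (drop_poly p (drop_poly p (rep u * rep v * rep w) * rep h))
      - trunc (drop_poly p (drop_poly p (rep u * rep v) * rep h * rep w)) in
    r f * g + r g * f.
  have E h : drop_poly p (rep (u * v) * rep w) * rep h
      = drop_poly p (rep u * rep v * rep w) * rep h
        - drop_poly p (rep u * rep v) * rep h * rep w.
    rewrite -{1}(repK u) -{1}(repK v) -truncM drop_rep_truncM mulrBl.
    ring.
  by rewrite /carry_bracket_fun !E !linearB /= !truncB.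
apply: cochain_ext3 => a b c.
rewrite (bracket22E (carry_cochain f)) !carry_cochainE hoch_diff2E !carry_bracketE.
rewrite !(carryC a (_ * _)) !carryMf.
have sym u v : carry_bracket_fun f g u v = carry_bracket_fun f g v u.
  by rewrite /carry_bracket_fun (mulrC (rep u)).
rewrite (sym a (b * c)) !bracketM.
rewrite /carry_bracket_fun.
have -> : rep b * rep c * rep a = rep a * rep b * rep c by ring.
ring.
Qed.

End Truncation.

(** * Derivations, and detection of coboundaries in degree 2 *)

Section Degree2Classes.
Variables (k : fieldType) (p : nat).
Hypothesis p_gt1 : (1 < p)%N.
Local Notation A := (truncpoly k p).
Local Notation x := (xA k p).
Implicit Types (a b c : A) (P Q : {poly k}).

(** The chain rule, for arbitrary lifts [P], so that it can be iterated without reducing modulo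
    [X^p]. *)
Lemma cocycle1_trunc (f : cochain A 1) P : f \in cocycles A 1 ->
  ev1 f (trunc p P) = trunc p P^`() * ev1 f x.
Proof.
move=> /cocycle1P df.
have f1 : ev1 f 1 = 0.
  have /eqP := df 1 1; rewrite !mulr1 mul1r -subr_eq0 opprD addrA subrr sub0r.
  by rewrite oppr_eq0 => /eqP.
have f0 : ev1 f 0 = 0 by have := df 0 0; rewrite !mul0r mulr0 addr0.
elim/poly_ind: P => [|P c IHP]; first by rewrite deriv0 trunc0 mul0r.
rewrite truncD addrC -alg_polyC truncZ trunc1 ev1_linear f1 scaler0 add0r.
have tX : trunc p 'X = x by [].
rewrite truncM tX df IHP.
rewrite derivD derivM derivX alg_polyC derivC addr0 mulr1 truncD truncM tX.
ring.
Qed.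

Definition cycle_eval (g : cochain A 2) : A :=
  \sum_(l < p) ev2 g (x ^+ l) x * x ^+ (p.-1 - l).

Lemma cycle_evalB g g' : cycle_eval (g - g') = cycle_eval g - cycle_eval g'.
Proof.
rewrite /cycle_eval -sumrB; apply: eq_bigr => l _.
by rewrite add_lfunE opp_lfunE mulrBl.
Qed.

(** Among the products of [x^l] and [x] only the one with [l = p - 1] reaches [X^p], and there the
    quotient is 1. *)
Lemma cycle_eval_carry c : cycle_eval (carry_cochain c) = c.
Proof.
have carryE l : (l < p)%N -> carry (x ^+ l) x = (l.+1 == p)%:R.
  move=> lt_lp; rewrite /carry rep_xA // -[X in rep X]expr1 rep_xA //.
  rewrite -exprD addn1; case: eqP => [->|/eqP ne_lp].
    by rewrite -[X in drop_poly p X]mul1r drop_polyMXn_id trunc1.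
  by rewrite drop_poly_eq0 ?trunc0 // size_polyXn ltn_neqAle ne_lp.
have lt_p1p : (p.-1 < p)%N by rewrite prednK // ltnW.
rewrite /cycle_eval (bigD1 (Ordinal lt_p1p)) //= subnn mulr1 big1 => [|l].
  by rewrite carry_cochainE // carryE // prednK ?(ltnW p_gt1) // eqxx mul1r addr0.
rewrite -val_eqE /= carry_cochainE // carryE // => ne_l.
suff -> : (l.+1 == p) = false by rewrite !mul0r.
by apply: contraNF ne_l => /eqP lp; rewrite -(eqn_add2r 1) !addn1 lp prednK // ltnW.
Qed.

(* A cochain [h] with [d h = g] is determined by [b := h x]: the identity     *)
(* [g (x^l, x) = (d h) (x^l, x)] is a recursion for [h (x^(l+1))], solved in  *)
(* closed form by [eta]; the condition at [l = p - 1] fixes [p b].            *)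
Lemma cycle_eval_coboundary (g : cochain A 2) : [pchar k] =i pred0 ->
  g \in cocycles A 2 -> x * cycle_eval g = 0 -> g \in coboundaries A 2.
Proof.
move=> char0 Zg xg0.
have p_neq0 : p%:R != 0 :> k.
  have := (pcharf0P _).1 char0 p => ->; by rewrite -lt0n ltnW.
pose mu := (rep (cycle_eval g))`_p.-1.
(* The annihilator of [x] is spanned by [x^(p-1)]. *)
have gE : cycle_eval g = mu *: x ^+ p.-1.
  rewrite -truncX -truncZ -[LHS]repK //; congr (trunc p _); apply/polyP => i.
  rewrite coefZ coefXn; case: eqP => [->|/eqP ne_i]; first by rewrite mulr1.
  rewrite mulr0; case: (ltnP i p) => [lt_ip|le_pi]; last first.
    by rewrite nth_default // (leq_trans (size_rep _ _)).
  have := congr1 (fun a => (rep a)`_i.+1) xg0.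
  rewrite -{1}(repK p_gt1 (cycle_eval g)) -(truncM _ 'X) repE // coef_take_poly.
  rewrite coefXM /= coef0; case: ifP => // /negbT; rewrite -leqNgt => le_pi1.
  by case/negP: ne_i; rewrite eqn_leq; apply/andP; split; lia.
pose b : A := (mu / p%:R)%:A.
pose eta m := m%:R * x ^+ m.-1 * b + x ^+ m * ev2 g 1 1
  - \sum_(l < m) ev2 g (x ^+ l) x * x ^+ (m.-1 - l).
have etaS m : eta m.+1 = x ^+ m * b + eta m * x - ev2 g (x ^+ m) x.
  rewrite /eta /= big_ord_recr /= subnn mulr1 mulrBl mulr_suml.
  rewrite (eq_bigr (fun l : 'I_m => ev2 g (x ^+ l) x * x ^+ (m.-1 - l) * x)).
    case: m => [|m] /=; first by rewrite big_ord0 !expr0 expr1; ring.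
    by rewrite -natr1 !exprS; ring.
  move=> l _; rewrite -mulrA -exprSr; congr (_ * x ^+ _).
  by have := ltn_ord l; lia.
have etap : eta p = 0.
  rewrite /eta [x ^+ p]xA_expr_ge // mul0r addr0 -[X in _ - X]/(cycle_eval g) gE /b.
  rewrite mulr_natl -scaler_nat -scalerAl -scalerAr mulr1 scalerA.
  by rewrite mulrC mulfVK // subrr.
pose L a : A := \sum_(m < p) (rep a)`_m *: eta m.
have linL : linear L.
  move=> l u v; rewrite /L scaler_sumr -big_split; apply: eq_bigr => m _ /=.
  by rewrite repD repZ coefD coefZ scalerDl scalerA.
have Lx m : (m <= p)%N -> L (x ^+ m) = eta m.
  rewrite leq_eqVlt => /orP[/eqP->|lt_mp].
    by rewrite etap xA_expr_ge // /L big1 // => i _; rewrite coef0 scale0r.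
  rewrite /L rep_xA // (bigD1 (Ordinal lt_mp)) //= coefXn eqxx scale1r.
  rewrite big1 ?addr0 // => i; rewrite -val_eqE /= coefXn => /negPf->.
  by rewrite scale0r.
have /cocycle2P dg := Zg.
have eta0 : eta 0 = ev2 g 1 1.
  by rewrite /eta big_ord0 mulr0n !mul0r add0r subr0 mul1r.
have h1 : L 1 = ev2 g 1 1 by rewrite -(expr0 x) Lx.
have hx : L x = b.
  (* The cocycle identity at [(1, 1, x)] gives [g (1, x) = g (1, 1) x], which leaves only [b] in
     [eta 1]. *)
  rewrite -[X in L X]expr1 Lx ?(ltnW p_gt1) // etaS eta0 !expr0 mul1r -addrA.
  have /eqP := dg 1 1 x; rewrite !mul1r subrr add0r subr_eq0 => /eqP ->.
  by rewrite subrr addr0.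
pose h : cochain A 1 := tlift 1 (fun s => L s`_0).
have hE a : ev1 h a = L a by rewrite /h tlift_pure //; apply: multilin1.
apply/memv_imgP; exists h; first exact: memvf.
apply/eqP; rewrite -subr_eq0; apply/eqP.
(* By construction [g - d h] vanishes when its second argument is [x]. The cocycle identity at
   [(a, x^n, x)] then propagates this to all powers of [x] in the second argument. *)
set g' := g - _.
have /cocycle2P dg' : g' \in cocycles A 2 by rewrite memvB ?hoch_diff12.
have g'E a c : ev2 g' a c = ev2 g a c - (a * L c - L (a * c) + L a * c).
  by rewrite /g' add_lfunE opp_lfunE hoch_diff1E !hE.
have g'x a : ev2 g' a x = 0.
  pose F := GRing.isLinear.Build k A A _ (fun a => ev2 g' a x) (ev2_linearl g' x).
  pose G : {linear A -> A} := HB.pack (fun a => ev2 g' a x) F.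
  apply: (linear_eq0_xA p_gt1 (L := G)) => n lt_np /=.
  by rewrite g'E hx -exprSr !Lx ?(ltnW lt_np) // etaS; ring.
have g'1 a : ev2 g' a 1 = 0.
  have := dg' a 1 1; rewrite !mulr1 subrK [ev2 g' 1 1]g'E !mulr1 !mul1r h1.
  by rewrite subrr add0r subrr mulr0 sub0r => /eqP; rewrite oppr_eq0 => /eqP.
have g'X a n : ev2 g' a (x ^+ n) = 0.
  elim: n => [|n IHn]; first exact: g'1.
  by have := dg' a (x ^+ n) x; rewrite !g'x IHn mulr0 mul0r !subr0 add0r -exprSr.
apply: cochain_ext2 => a c; rewrite zero_lfunE.
pose F := GRing.isLinear.Build k A A _ (fun c => ev2 g' a c) (ev2_linearr g' a).
pose G : {linear A -> A} := HB.pack (fun c => ev2 g' a c) F.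
by apply: (linear_eq0_xA p_gt1 (L := G)) => n _; apply: g'X.
Qed.

End Degree2Classes.

(** * Brackets of derivations and carry cocycles up to coboundaries *)

Section CarryBrackets.
Variables (k : fieldType) (p : nat).
Hypothesis p_gt1 : (1 < p)%N.
Local Notation A := (truncpoly k p).
Local Notation x := (xA k p).
Implicit Types (a b c : A) (P Q : {poly k}).

(** The classification of degree 2 classes by [A / (x^(p-1))]: a cocycle and a carry cocycle are
    compared through [cycle_eval] alone. *)
Lemma sub_carry_coboundary (g : cochain A 2) c : [pchar k] =i pred0 ->
  g \in cocycles A 2 -> x * cycle_eval g = x * c ->
  g - carry_cochain c \in coboundaries A 2.
Proof.
move=> char0 Zg xg; apply: cycle_eval_coboundary => //.
  by rewrite memvB // carry_cochain_cocycle.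
by rewrite cycle_evalB cycle_eval_carry // mulrBr xg subrr.
Qed.

Lemma bracket12Br (f : cochain A 1) (g h : cochain A 2) :
  bracket f (g - h) = bracket f g - bracket f h.
Proof.
move: (bracket12E f (g - h)) (bracket12E f g) (bracket12E f h).
move: (bracket f (g - h)) (bracket f g) (bracket f h) => B1 B2 B3.
move=> E1 E2 E3; apply: cochain_ext2 => a b.
by rewrite add_lfunE opp_lfunE E1 E2 E3 !add_lfunE !opp_lfunE ev1B; ring.
Qed.

Lemma bracket22Bl (f g h : cochain A 2) :
  bracket (f - g) h = bracket f h - bracket g h.
Proof.
move: (bracket22E (f - g) h) (bracket22E f h) (bracket22E g h).
move: (bracket (f - g) h) (bracket f h) (bracket g h) => B1 B2 B3.
move=> E1 E2 E3; apply: cochain_ext3 => a b c.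
by rewrite add_lfunE opp_lfunE E1 E2 E3 !add_lfunE !opp_lfunE ev2Bl ev2Br; ring.
Qed.

Lemma bracket22_coboundary (g h : cochain A 2) : [pchar k] =i pred0 ->
  g \in cocycles A 2 -> h \in cocycles A 2 ->
  bracket g h \in coboundaries A 3.
Proof.
move=> char0.
have cob u v : u \in coboundaries A 2 -> v \in cocycles A 2 ->
    bracket u v \in coboundaries A 3.
  case/memv_imgP => w _ -> Zv; rewrite bracket_hoch_diff22 //.
  by rewrite memvN memv_img // memvf.
have red u v : u \in cocycles A 2 -> v \in cocycles A 2 ->
    bracket (carry_cochain (cycle_eval u)) v \in coboundaries A 3 ->
    bracket u v \in coboundaries A 3.
  move=> Zu Zv Buv.
  rewrite -[bracket u v](subrK (bracket (carry_cochain (cycle_eval u)) v)).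
  apply: (memvD _ Buv); rewrite -bracket22Bl.
  exact: (cob _ _ (sub_carry_coboundary char0 Zu (erefl _)) Zv).
move=> Zg Zh.
(* Symmetry of the bracket lets the same reduction treat the second argument. *)
apply: (red _ _ Zg Zh); rewrite bracket22_sym.
apply: (red _ _ Zh (carry_cochain_cocycle p_gt1 _)); rewrite bracket_carry_cochain //.
by rewrite memv_img // memvf.
Qed.

(** As [f x] is a multiple of [x], the lift [D] of [f] preserves the ideal of [X^p]:
    [D(q X^p) = (D q + p y q) X^p]. The last summand yields the term with [p]. *)
Lemma bracket12_carry (f : cochain A 1) c y : f \in cocycles A 1 ->
  ev1 f x = x * y ->
  bracket f (carry_cochain c) - carry_cochain (ev1 f c - (y * c) *+ p)
    \in coboundaries A 2.
Proof.
move=> Zf fx; have /cocycle1P df := Zf.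
pose D P := P^`() * 'X * rep y.
have fE P : ev1 f (trunc p P) = trunc p (D P).
  by rewrite cocycle1_trunc // fx /D -mulrA !truncM repK.
(* [D (rep a)] lifts [f a] but may have degree at least [p]; the homotopy records this overflow. *)
pose eta a := trunc p (drop_poly p (D (rep a))) * c.
have lin : linear eta.
  move=> l u v; rewrite /eta /D repD repZ derivD derivZ !mulrDl -!scalerAl.
  by rewrite drop_polyD drop_polyZ truncD truncZ mulrDl -scalerAl.
pose h : cochain A 1 := tlift 1 (fun s => eta s`_0).
have hE a : ev1 h a = eta a by rewrite /h tlift_pure //; apply: multilin1.
suff -> : bracket f (carry_cochain c) - carry_cochain (ev1 f c - (y * c) *+ p)
    = hoch_diff A 1 h by rewrite memv_img // memvf.
apply: cochain_ext2 => a b; rewrite add_lfunE opp_lfunE hoch_diff1E !hE.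
rewrite (bracket12E f (carry_cochain c)) !carry_cochainE // df.
have carryf u v : carry (ev1 f u) v = trunc p (drop_poly p (D (rep u) * rep v))
    - trunc p (drop_poly p (D (rep u))) * v.
  by rewrite -{1}(repK p_gt1 u) fE carry_truncl.
rewrite (carryC a (ev1 f b)) !carryf /eta.
have DM P Q : D (P * Q) = D P * Q + D Q * P by rewrite /D derivM; ring.
(* [D] is applied to the division of the product of the lifts by [X^p], and quotients are
   compared. *)
have key : trunc p (drop_poly p (D (rep (a * b))))
  = trunc p (drop_poly p (D (rep a) * rep b))
    + trunc p (drop_poly p (D (rep b) * rep a))
    - ev1 f (carry a b) - (y * carry a b) *+ p.
  have -> : rep (a * b) = rep a * rep b - drop_poly p (rep a * rep b) * 'X^p.
    by rewrite -{1}(repK p_gt1 a) -{1}(repK p_gt1 b) -truncM rep_trunc.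
  set d := drop_poly p (rep a * rep b).
  have -> : D (rep a * rep b - d * 'X^p) = D (rep a) * rep b + D (rep b) * rep a
      - (D d + (d * rep y) *+ p) * 'X^p.
    have <- : D (d * 'X^p) = (D d + (d * rep y) *+ p) * 'X^p.
      rewrite /D derivM derivXn.
      have -> : 'X^p = 'X * 'X^(p.-1) :> {poly k} by rewrite -exprS prednK // ltnW.
      by rewrite -[X in _ + d * X]mulr_natr -[X in _ = (_ + X) * _]mulr_natr; ring.
    by rewrite -DM /D derivB !mulrBl.
  rewrite linearB linearD /= drop_polyMXn_id truncB !truncD truncMn truncM repK //.
  by rewrite -fE -[trunc p d]/(carry a b); ring.
rewrite key; ring.
Qed.

End CarryBrackets.

(** * Linear maps tested on pure tensors *)

Lemma lfunB (k : fieldType) (V W : vectType k) (f : 'Hom(V, W)) u v :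
  f (u - v) = f u - f v.
Proof. exact: linearB. Qed.

Lemma lfunD (k : fieldType) (V W : vectType k) (f : 'Hom(V, W)) u v :
  f (u + v) = f u + f v.
Proof. exact: linearD. Qed.

Lemma lfunN (k : fieldType) (V W : vectType k) (f : 'Hom(V, W)) u :
  f (- u) = - f u.
Proof. exact: linearN. Qed.

Lemma lfun_sum (k : fieldType) (V W : vectType k) (f : 'Hom(V, W))
    (I : finType) (F : I -> V) : f (\sum_i F i) = \sum_i f (F i).
Proof. exact: linear_sum. Qed.

Lemma tens_linear_ext (k : fieldType) (V W : vectType k) n
    (L M : tens V n -> W) : linear L -> linear M ->
  (forall s, size s = n -> L (tpure n s) = M (tpure n s)) -> L =1 M.
Proof.
move=> linL linM eqLM t.
pose FL := GRing.isLinear.Build k (tens V n) W _ L linL.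
pose FM := GRing.isLinear.Build k (tens V n) W _ M linM.
pose L' : {linear tens V n -> W} := HB.pack L FL.
pose M' : {linear tens V n -> W} := HB.pack M FM.
suff : linfun L' = linfun M' by move/lfunP/(_ t); rewrite !lfunE.
by apply: tens_ext => s sz; rewrite !lfunE /= eqLM.
Qed.

Lemma linear_lfun (k : fieldType) (U V W : vectType k) (f : 'Hom(V, W))
  (L : U -> V) : linear L -> linear (fun u => f (L u)).
Proof. by move=> linL l u v; rewrite linL linearP. Qed.

Lemma linear_subf (k : fieldType) (U V : vectType k) (L M : U -> V) :
  linear L -> linear M -> linear (fun u => L u - M u).
Proof. by move=> linL linM l u v; rewrite linL linM scalerBr opprD addrACA. Qed.

Lemma linear_sumf (k : fieldType) (U V : vectType k) (I : finType)
  (L : I -> U -> V) : (forall i, linear (L i)) -> linear (fun u => \sum_i L i u).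
Proof.
move=> linL l u v; rewrite scaler_sumr -big_split.
by apply: eq_bigr => i _; apply: linL.
Qed.

Lemma bilinear_hom (k : fieldType) (V W : vectType k) (B : V -> V -> W) :
  (forall b, linear (B^~ b)) -> (forall a, linear (B a)) ->
  exists E : 'Hom(tens V 2, W), forall a b, E (tpure 2 [:: a; b]) = B a b.
Proof.
move=> linl linr; exists (tlift 2 (fun s => B s`_0 s`_1)) => a b.
by rewrite tlift_pure //; apply: multilin2.
Qed.

(** * The periodic resolution *)

Section Periodic.
Variables (k : fieldType) (p : nat).
Hypothesis p_gt1 : (1 < p)%N.
Local Notation A := (truncpoly k p).
Local Notation x := (xA k p).
Local Notation aug := (augmentation A).
Implicit Types (a b c : A) (t : tens A 2).

Lemma ends_mul0_pure a b c c' :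
  ends_mul 0 a b (tpure 2 [:: c; c']) = tpure 2 [:: a * c; c' * b].
Proof. exact: (ends_mul_pure (n := 0) _ _ _ _ (s := [::])). Qed.

Lemma augmentation_ends_mul a b t : aug (ends_mul 0 a b t) = a * b * aug t.
Proof.
apply: (tens_linear_ext (L := fun t => aug (ends_mul 0 a b t))
          (M := fun t => a * b * aug t)).
- by apply: linear_lfun => l u v; apply: linearP.
- by move=> l u v; rewrite linearP mulrDr scalerAr.
- move=> [|c [|c' []]] // _.
  by rewrite ends_mul0_pure !augmentation_pure; ring.
Qed.

(** [A] is commutative, so the enveloping algebra acts on it through multiplication. *)
Lemma env_orbitE c t : env_orbit c t = c * aug t.
Proof.
apply: (tens_linear_ext (L := env_orbit c) (M := fun t => c * aug t)).
- exact: linearP.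
- by move=> l u v; rewrite linearP mulrDr scalerAr.
- move=> [|a [|b []]] // _.
  apply: etrans (env_orbit_pure c a b) _.
  by rewrite augmentation_pure mulrA (mulrC a).
Qed.

Lemma env_act_u n (t : tens A n.+2) :
  env_act (per_u k p) t = ends_mul n x 1 t - ends_mul n 1 x t.
Proof.
rewrite /per_u addrC -scaleN1r env_act_linear !env_act_pure scaleN1r.
by rewrite addrC.
Qed.

Lemma env_act_v n (t : tens A n.+2) :
  env_act (per_v k p) t = \sum_(i < p) ends_mul n (x ^+ (p.-1 - i)) (x ^+ i) t.
Proof.
have -> : env_act (per_v k p) t
    = \sum_(i < p) env_act (tpure 2 [:: x ^+ (p.-1 - i); x ^+ i]) t.
  exact: linear_sum.
by apply: eq_bigr => i _; rewrite env_act_pure.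
Qed.

Lemma augmentation_u t : aug (env_act (n := 0) (per_u k p) t) = 0.
Proof.
rewrite env_act_u lfunB.
transitivity (x * 1 * aug t - 1 * x * aug t).
  by congr (_ - _); apply: augmentation_ends_mul.
by rewrite [x * 1]mulr1 [1 * x]mul1r subrr.
Qed.

Lemma augmentation_v t :
  aug (env_act (n := 0) (per_v k p) t) = (x ^+ p.-1 * aug t) *+ p.
Proof.
rewrite env_act_v lfun_sum -[X in _ *+ X](card_ord p) -sumr_const.
apply: eq_bigr => i _; rewrite augmentation_ends_mul -exprD subnK //.
by rewrite -ltnS prednK // ltnW.
Qed.

(* [a (x) b |-> x a' b] recovers [aug t] up to [Ann x] from [u t].            *)
Lemma x_augmentation_u : exists E : 'Hom(tens A 2, A),
  forall t, E (env_act (n := 0) (per_u k p) t) = x * aug t.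
Proof.
pose D a := trunc p ('X * (rep a)^`()).
have linD : linear D.
  move=> l u v; rewrite /D repD repZ derivD derivZ mulrDr -scalerAr.
  by rewrite truncD truncZ.
have tX : trunc p 'X = x by [].
have DM a : D (x * a) = x * a + x * D a.
  have -> : D (x * a) = trunc p ('X * ('X * rep a)^`()).
    rewrite /D -{1}(repK p_gt1 a) -tX -truncM rep_trunc //.
    set d := drop_poly _ _; rewrite derivB (derivM d) derivXn mulrBr truncB.
    rewrite [X in _ - X](_ : _ = 0) ?subr0 // mulrDr truncD !truncM truncX.
    rewrite xA_expr_ge // !mulr0 add0r truncMn truncX mulrnAr tX mulrnAr.
    by rewrite mulrCA -exprS prednK ?(ltnW p_gt1) // xA_expr_ge // mulr0 mul0rn.
  rewrite derivM derivX mul1r mulrDr truncD /D !truncM repK // tX; ring.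
have [||E EE] := bilinear_hom (B := fun a b => D a * b).
- by move=> b l u v; rewrite linD mulrDl -scalerAl.
- by move=> b l u v; rewrite mulrDr -scalerAr.
exists E => t; rewrite env_act_u lfunB.
apply: (tens_linear_ext (M := fun t => x * aug t)
  (L := fun t => E (ends_mul 0 x 1 t) - E (ends_mul 0 1 x t))).
- by apply: linear_subf; apply: linear_lfun => l u v; apply: linearP.
- by move=> l u v; rewrite linearP mulrDr scalerAr.
- move=> [|a [|b []]] // _.
  have EM u v : E (ends_mul 0 u v (tpure 2 [:: a; b])) = D (u * a) * (b * v).
    by rewrite ends_mul0_pure EE.
  apply: etrans (congr2 (fun u v => u - v) (EM x 1) (EM 1 x)) _.
  by rewrite augmentation_pure [b * 1]mulr1 [1 * a]mul1r DM; ring.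
Qed.

(* [a (x) b |-> (coefficient of x^(p-1) in a) b] undoes [v] up to [aug].      *)
Lemma augmentation_of_v : exists E : 'Hom(tens A 2, A),
  forall t, E (env_act (n := 0) (per_v k p) t) = aug t.
Proof.
pose lam a := (rep a)`_p.-1.
have lamE a (i : 'I_p) : lam (x ^+ (p.-1 - i) * a) = (rep a)`_i.
  have le_ip : (i <= p.-1)%N by rewrite -ltnS prednK // ltnW.
  rewrite /lam -{1}(repK p_gt1 a) -truncX -truncM repE // coef_take_poly.
  by rewrite prednK ?leqnn ?(ltnW p_gt1) // coefXnM ltnNge leq_subr subKn.
have sumE a : \sum_(i < p) (rep a)`_i *: x ^+ i = a.
  rewrite -[RHS](repK p_gt1) -[in RHS](take_poly_id (size_rep p_gt1 a)) /take_poly.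
  rewrite poly_def (big_morph _ (@truncD k p) (trunc0 k p)).
  by apply: eq_bigr => i _; rewrite truncZ truncX.
have [||E EE] := bilinear_hom (B := fun a b => lam a *: b).
- by move=> b l u v; rewrite /lam repD repZ coefD coefZ scalerDl scalerA.
- by move=> b l u v; rewrite scalerDr !scalerA mulrC.
exists E => t; rewrite env_act_v lfun_sum.
apply: (tens_linear_ext (M := fun t => aug t)
  (L := fun t => \sum_(i < p) E (ends_mul 0 (x ^+ (p.-1 - i)) (x ^+ i) t))).
- by apply: linear_sumf => i; apply: linear_lfun => l u v; apply: linearP.
- exact: linearP.
- move=> [|a [|b []]] // _.
  rewrite augmentation_pure -[a in RHS]sumE mulr_suml; apply: eq_bigr => i _.
  by rewrite ends_mul0_pure EE lamE -scalerAl mulrC.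
Qed.
End Periodic.

Lemma multilin0 (k : fieldType) (V W : vectType k) n (F : seq V -> W) :
  multilin n F -> forall s1 s2, (size s1 + size s2).+1 = n ->
  F (s1 ++ 0 :: s2) = 0.
Proof.
move=> mF s1 s2 sz; have := mF s1 s2 (-1) 0 0 sz.
by rewrite scaler0 addr0 scaleN1r addNr.
Qed.

(** * What every comparison map must satisfy *)

Section Comparison.
Variables (k : fieldType) (p : nat).
Hypothesis p_gt1 : (1 < p)%N.
Local Notation A := (truncpoly k p).
Local Notation x := (xA k p).
Local Notation aug := (augmentation A).
Variable Psi : forall n : nat, 'Hom(bar A n, per k p n).
Hypothesis Psi_comparison : comparison_map Psi.
Implicit Types (a b c : A).

Lemma comparison_ends_mul n a b (t : bar A n) :
  Psi n (ends_mul n a b t) = ends_mul 0 a b (Psi n t).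
Proof.
by case: Psi_comparison => PsiZ _ _; rewrite -!env_act_pure; apply: PsiZ.
Qed.

Lemma comparison_bar_diff0 (t : bar A 1) :
  env_act (n := 0) (per_u k p) (Psi 1 t) = Psi 0 (bar_diff A 0 t).
Proof. by case: Psi_comparison => _ _ Psid; apply: Psid. Qed.

Lemma comparison_bar_diff1 (t : bar A 2) :
  env_act (n := 0) (per_v k p) (Psi 2 t) = Psi 1 (bar_diff A 1 t).
Proof. by case: Psi_comparison => _ _ Psid; apply: Psid. Qed.

Lemma comparison_bar_diff2 (t : bar A 3) :
  env_act (n := 0) (per_u k p) (Psi 3 t) = Psi 2 (bar_diff A 2 t).
Proof. by case: Psi_comparison => _ _ Psid; apply: Psid. Qed.

Definition xi_cochain n j : cochain A n :=
  bar_restrict (xi_dual k p n j \o Psi n)%VF.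

Lemma xi_cochainE n j s : size s = n ->
  xi_cochain n j (tpure n s) = x ^+ j * aug (Psi n (tpure n.+2 (1 :: rcons s 1))).
Proof.
move=> sz; rewrite /xi_cochain bar_restrict_pure // comp_lfunE.
exact: env_orbitE.
Qed.

(** The chain map equation says that [Psi 1] of this tensor and [Psi 0] of 1 (x) 1 have the same
    product with [u], and the latter has augmentation 1. The factor [x] remains because [Psi] is
    unique only up to homotopy, which can add multiples of [x^(p-1)]. *)
Lemma augmentation_comparison1 : x * aug (Psi 1 (tpure 3 [:: 1; x; 1])) = x.
Proof.
have [E EE] := x_augmentation_u k p_gt1.
have [_ Psi0 _] := Psi_comparison.
have aug1 : aug (Psi 0 (tpure 2 [:: 1; 1])) = 1.
  by rewrite (Psi0 (tpure 2 [:: 1; 1])) augmentation_pure mulr1.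
rewrite -EE comparison_bar_diff0 bar_diff_pure //.
rewrite !big_ord_recl big_ord0 addr0 !scale_signr /=.
rewrite /merge_at /= mulr1 mul1r.
have -> : tpure 2 [:: x; 1] - tpure 2 [:: 1; x]
    = env_act (n := 0) (per_u k p) (tpure 2 [:: 1; 1]).
  rewrite env_act_u; congr (_ - _); apply/esym.
    by apply: etrans (ends_mul0_pure _ _ _ _) _; rewrite !mulr1.
  by apply: etrans (ends_mul0_pure _ _ _ _) _; rewrite !mul1r.
by have [-> _ _] := Psi_comparison; rewrite EE aug1 mulr1.
Qed.

Lemma bar_diff_x_cycle :
  bar_diff A 1 (\sum_(l < p) tpure 4 [:: 1; x ^+ l; x; x ^+ (p.-1 - l)])
    = env_act (n := 1) (per_v k p) (tpure 3 [:: 1; x; 1]).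
Proof.
rewrite env_act_v lfun_sum.
pose F l := tpure 3 [:: 1; x ^+ l; x ^+ (p - l)].
have dE (l : 'I_p) : bar_diff A 1 (tpure 4 [:: 1; x ^+ l; x; x ^+ (p.-1 - l)])
    = tpure 3 [:: x ^+ l; x; x ^+ (p.-1 - l)] + (F l - F l.+1).
  rewrite bar_diff_pure // !big_ord_recl big_ord0 addr0 !scale_signr /=.
  rewrite /merge_at /= mul1r -exprSr -exprS /F [(p - l)%N](_ : _ = (p.-1 - l).+1).
    have -> : (p - l.+1 = p.-1 - l)%N by lia.
    by congr (_ + _); apply: addrC.
  by have := ltn_ord l; lia.
rewrite (eq_bigr _ (fun l _ => dE l)) big_split /=.
(* Telescoping leaves [F 0 - F p], and each of the two contains the entry [x^p = 0]. *)
have -> : \sum_(l < p) (F l - F l.+1) = 0.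
  rewrite -(big_mkord xpredT (fun l => F l - F l.+1)).
  rewrite -[LHS]opprK -sumrN (eq_bigr (fun l => F l.+1 - F l)) => [|l _].
    rewrite telescope_sumr // /F subnn subn0 xA_expr_ge //.
    rewrite (multilin0 (multilin_tpure (n := 3)) (s1 := [:: _]) (s2 := [:: _])) //.
    rewrite (multilin0 (multilin_tpure (n := 3)) (s1 := [:: _; _]) (s2 := [::])) //.
    by rewrite subrr oppr0.
  by rewrite opprB.
rewrite addr0 [RHS](reindex_inj rev_ord_inj) /=; apply: eq_bigr => l _.
apply/esym; apply: etrans (ends_mul_pure (n := 1) _ _ _ _ (s := [:: _]) _) _ => //.
rewrite mulr1 mul1r /=; have -> : (p.-1 - (p - l.+1) = l)%N by have := ltn_ord l; lia.
by have -> : (p - l.+1 = p.-1 - l)%N by lia.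
Qed.

(** Both sides come from elements with the same product with [v], and multiplication by [v]
    determines the augmentation. *)
Lemma augmentation_comparison2 :
  aug (Psi 2 (\sum_(l < p) tpure 4 [:: 1; x ^+ l; x; x ^+ (p.-1 - l)]))
    = aug (Psi 1 (tpure 3 [:: 1; x; 1])).
Proof.
have [E EE] := augmentation_of_v k p_gt1.
rewrite -EE comparison_bar_diff1 bar_diff_x_cycle -EE; congr (E _).
by have [PsiZ _ _] := Psi_comparison; apply: PsiZ.
Qed.

Lemma cycle_eval_xi j : x * cycle_eval (xi_cochain 2 j) = x ^+ j.+1.
Proof.
set z := \sum_(l < p) tpure 4 [:: 1; x ^+ l; x; x ^+ (p.-1 - l)].
have -> : cycle_eval (xi_cochain 2 j) = x ^+ j * aug (Psi 2 z); last first.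
  by rewrite augmentation_comparison2 mulrCA augmentation_comparison1 exprSr.
rewrite /cycle_eval !lfun_sum mulr_sumr; apply: eq_bigr => l _.
rewrite xi_cochainE // -mulrA; congr (_ * _).
have -> : tpure 4 [:: 1; x ^+ l; x; x ^+ (p.-1 - l)]
    = ends_mul 2 1 (x ^+ (p.-1 - l)) (tpure 4 [:: 1; x ^+ l; x; 1]).
  by rewrite (ends_mul_pure (n := 2) _ _ _ _ (s := [:: _; _])) //= !mul1r.
by rewrite comparison_ends_mul augmentation_ends_mul mul1r mulrC.
Qed.

Lemma augmentation_comparison_ends n a b s : size s = n ->
  aug (Psi n (tpure n.+2 (a :: rcons s b)))
    = a * b * aug (Psi n (tpure n.+2 (1 :: rcons s 1))).
Proof.
move=> sz; rewrite -augmentation_ends_mul -comparison_ends_mul.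
by rewrite ends_mul_pure // mulr1 mul1r.
Qed.

(** The obstruction is the action of [v] on [A], multiplication by [p x^(p-1)], which [x^j] kills
    for positive [j]. *)
Lemma xi_cochain1_cocycle j : (0 < j)%N -> xi_cochain 1 j \in cocycles A 1.
Proof.
move=> j_gt0; rewrite memv_ker; apply/eqP/cochain_ext2 => a b.
rewrite zero_lfunE hoch_diff1E !xi_cochainE //=.
have := comparison_bar_diff1 (tpure 4 [:: 1; a; b; 1]).
rewrite bar_diff_pure // !big_ord_recl big_ord0 addr0 !scale_signr /=.
rewrite /merge_at /= mul1r mulr1 => /(congr1 (fun t => x ^+ j * aug t)).
rewrite augmentation_v // mulrnAr mulrA -exprD xA_expr_ge //; last by lia.
rewrite mul0r mul0rn !(lfunD, lfunN).
rewrite (augmentation_comparison_ends a 1 (s := [:: b])) //.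
rewrite (augmentation_comparison_ends 1 b (s := [:: a])) //= => E.
by rewrite [RHS]E; ring.
Qed.

(** Here the next differential is [u], which acts on [A] as zero. *)
Lemma xi_cochain2_cocycle j : xi_cochain 2 j \in cocycles A 2.
Proof.
apply/cocycle2P => a b c; rewrite !xi_cochainE //=.
have := comparison_bar_diff2 (tpure 5 [:: 1; a; b; c; 1]).
rewrite bar_diff_pure // !big_ord_recl big_ord0 addr0 !scale_signr /=.
rewrite /merge_at /= mul1r mulr1 => /(congr1 (fun t => x ^+ j * aug t)).
rewrite augmentation_u mulr0 !(lfunD, lfunN).
rewrite (augmentation_comparison_ends a 1 (s := [:: b; c])) //.
rewrite (augmentation_comparison_ends 1 c (s := [:: a; b])) //= => E.
by rewrite [RHS]E; ring.
Qed.

Lemma xi_cochain1E i P : (0 < i)%N ->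
  ev1 (xi_cochain 1 i) (trunc p P) = trunc p P^`() * x ^+ i.
Proof.
move=> i_gt0; rewrite cocycle1_trunc ?xi_cochain1_cocycle //; congr (_ * _).
by rewrite xi_cochainE //= -(prednK i_gt0) exprSr -mulrA augmentation_comparison1.
Qed.
End Comparison.

(** Inner derivations of a commutative algebra vanish, so degree 1 classes have a unique
    representative. *)
Lemma coboundary1_eq0 (k : fieldType) (p : nat) (f : cochain (truncpoly k p) 1) :
  f \in coboundaries (truncpoly k p) 1 -> f = 0.
Proof.
case/memv_imgP => c _ ->; apply: cochain_ext1 => a.
rewrite zero_lfunE hoch_diff_pure // big_ord0 addr0 scale_signr /=.
by rewrite mulrC subrr.
Qed.

Lemma HH_bracket_repr (k : fieldType) (A : falgType k) m n
    (c : HH A m) (d : HH A n) f g :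
  vsval (repr c) = f -> vsval (repr d) = g ->
  HH_bracket c d = HH_class (bracket f g).
Proof. by move=> <- <-. Qed.

(** * The brackets of the classes on the periodic resolution *)

Section Brackets.
Variables (k : fieldType) (p : nat).
Hypothesis char0 : [pchar k] =i pred0.
Hypothesis p_gt1 : (1 < p)%N.
Local Notation A := (truncpoly k p).
Local Notation x := (xA k p).
Variable Psi : forall n : nat, 'Hom(bar A n, per k p n).
Hypothesis Psi_comparison : comparison_map Psi.
Local Notation xi := (xi_cochain Psi).

Lemma repr_xi_class1 i : (0 < i)%N -> vsval (repr (xi_class Psi 1 i)) = xi 1 i.
Proof.
move=> i_gt0; apply/eqP; rewrite -subr_eq0; apply/eqP/coboundary1_eq0.
exact/repr_HH_class/xi_cochain1_cocycle.
Qed.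

Lemma bracket_xi11 i j : (0 < i)%N -> (0 < j)%N ->
  bracket (xi 1 i) (xi 1 j) = xi 1 (i + j - 1) *~ (j%:Z - i%:Z).
Proof.
case: i j => [|i] [|j] // _ _.
have -> : (i.+1 + j.+1 - 1 = (i + j).+1)%N by lia.
have xiE n P : ev1 (xi 1 n.+1) (trunc p P) = trunc p (P^`() * 'X^(n.+1)).
  by rewrite xi_cochain1E // truncM truncX.
have xi2E m n P : ev1 (xi 1 m.+1) (ev1 (xi 1 n.+1) (trunc p P))
    = trunc p ((P^`() * 'X^(n.+1))^`() * 'X^(m.+1)).
  exact: etrans (congr1 (fun a => ev1 (xi 1 m.+1) a) (xiE n P)) (xiE m _).
apply: cochain_ext1 => a; rewrite -(repK p_gt1 a).
apply: etrans (bracket11E (xi 1 i.+1) (xi 1 j.+1) _) _.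
rewrite -scaler_int scale_lfunE scaler_int.
apply: etrans (congr2 (fun u v => u - v) (xi2E i j _) (xi2E j i _)) _.
apply: etrans _ (congr1 (fun u => u *~ _) (esym (xiE _ _))).
rewrite !derivM !derivXn /= !(truncM, truncD, truncMn, truncX) mulrzBr -!pmulrn.
rewrite !exprS !exprD; ring.
Qed.

(** [g] is to be the representative picked inside [HH_bracket], known only up to a coboundary. *)
Lemma bracket_xi12 i j (g : cochain A 2) : (0 < i)%N ->
  g - xi 2 j \in coboundaries A 2 ->
  bracket (xi 1 i) g - xi 2 (i + j - 1) *~ (j%:Z - p%:Z) \in coboundaries A 2.
Proof.
move=> i_gt0 Bg; set f := xi 1 i; set m := (_ - p%:Z).
have Zf : f \in cocycles A 1 by apply: xi_cochain1_cocycle.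
have xiB n : xi 2 n - carry_cochain (x ^+ n) \in coboundaries A 2.
  apply: (sub_carry_coboundary p_gt1 char0 (xi_cochain2_cocycle Psi_comparison n)).
  by rewrite cycle_eval_xi // exprS.
have fB : bracket f (g - carry_cochain (x ^+ j)) \in coboundaries A 2.
  have : g - carry_cochain (x ^+ j) \in coboundaries A 2.
    by have := memvD Bg (xiB j); rewrite addrA subrK.
  by case/memv_imgP => h _ ->; rewrite bracket_hoch_diff12 // memv_img // memvf.
have fx : ev1 f x = x * x ^+ i.-1.
  have -> : x = trunc p 'X by [].
  by rewrite xi_cochain1E // derivX trunc1 mul1r -exprS prednK.
have fxj : ev1 f (x ^+ j) - (x ^+ i.-1 * x ^+ j) *+ p = x ^+ (i + j - 1) *~ m.
  rewrite -truncX xi_cochain1E // derivXn truncMn !truncX /m mulrzBr -!pmulrn.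
  case: i i_gt0 {f Zf fB fx} => // i _; rewrite addSn subn1 /= -exprD; congr (_ - _).
  (* For [j = 0] the exponent [j.-1] is truncated, but its coefficient [j] vanishes. *)
  by case: (j) => [|j'] /=; rewrite ?mulr0n ?mul0r // mulrnAl -exprD addnC addSnnS.
have cB : bracket f (carry_cochain (x ^+ j))
    - carry_cochain (x ^+ (i + j - 1)) *~ m \in coboundaries A 2.
  have cE := etrans (congr1 (@carry_cochain k p) fxj) (carry_cochainMz _ m).
  exact: (eq_ind _ (fun u : cochain A 2 => bracket f (carry_cochain (x ^+ j)) - u
    \in coboundaries A 2) (bracket12_carry p_gt1 (x ^+ j) Zf fx) _ cE).
rewrite bracket12Br in fB; have := memvD fB cB; rewrite addrA subrK => gB.
have mB : (carry_cochain (x ^+ (i + j - 1)) - xi 2 (i + j - 1)) *~ m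
    \in coboundaries A 2.
  by rewrite -scaler_int; apply: memvZ; rewrite -opprB memvN; apply: xiB.
by have := memvD gB mB; rewrite mulrzBl addrA subrK.
Qed.
End Brackets.

Theorem mainTheorem3 (k : fieldType) (p : nat)
    (k_char0 : [pchar k] =i pred0) (p_gt2 : (2 < p)%N)
    (Psi : forall n : nat, 'Hom(bar (truncpoly k p) n, per k p n))
    (Psi_comparison : comparison_map Psi) :
  [/\ forall i j : nat, (1 <= i <= p.-1)%N -> (1 <= j <= p.-1)%N ->
        HH_bracket (xi_class Psi 1 i) (xi_class Psi 1 j)
          = xi_class Psi 1 (i + j - 1) *~ (j%:Z - i%:Z),
      forall i j : nat, (1 <= i <= p.-1)%N -> (j <= p.-1)%N ->
        HH_bracket (xi_class Psi 1 i) (xi_class Psi 2 j)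
          = xi_class Psi 2 (i + j - 1) *~ (j%:Z - p%:Z)
    & forall i j : nat, (i <= p.-1)%N -> (j <= p.-1)%N ->
        HH_bracket (xi_class Psi 2 i) (xi_class Psi 2 j) = 0].
Proof.
have p_gt1 : (1 < p)%N by apply: ltnW.
have Z2 := xi_cochain2_cocycle Psi_comparison.
split=> [i j /andP[i_gt0 _] /andP[j_gt0 _]|i j /andP[i_gt0 _] _|i j _ _].
- rewrite (HH_bracket_repr (repr_xi_class1 p_gt1 Psi_comparison i_gt0)
    (repr_xi_class1 p_gt1 Psi_comparison j_gt0)).
  rewrite (bracket_xi11 p_gt1 Psi_comparison i_gt0 j_gt0).
  exact: HH_classMz.
- rewrite (HH_bracket_repr (repr_xi_class1 p_gt1 Psi_comparison i_gt0) (erefl _)).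
  rewrite -HH_classMz.
  have B := bracket_xi12 k_char0 p_gt1 Psi_comparison i_gt0 (repr_HH_class (Z2 j)).
  have Zm : xi_cochain Psi 2 (i + j - 1) *~ (j%:Z - p%:Z) \in cocycles _ 2.
    by rewrite -scaler_int memvZ.
  apply/(HH_class_eqP (n := 2)) => //.
  (* The bracket is a cocycle, being a coboundary plus a multiple of a cocycle. *)
  by have := memvD (coboundaries_sub_cocycles2 B) Zm; rewrite subrK.
- have B := bracket22_coboundary p_gt1 k_char0 (cocycle_repr (xi_class Psi 2 i))
    (cocycle_repr (xi_class Psi 2 j)).
  exact: (HH_class_eq0 (coboundaries_sub_cocycles3 B) B).
Qed.
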